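(* For each integer $m\geq 2$ and each $\epsilon>0$ there is a $\delta$ with $0<\delta<\epsilon$ such that, for all sufficiently large $n$, if $\sigma\in\mathfrak{S}_n$ has the $(\delta,\epsilon,m^{-1})$-property, then $\sigma$ is $m$-universal.
   Context: $\mathfrak{S}_n$ is the set of permutations of $\mathbb{Z}_n$, where $\mathbb{Z}_n$ is identified with $\{0,1,\ldots,n-1\}$ with its usual linear order; an interval of $\mathbb{Z}_n$ is a set of consecutive integers in it. A permutation $\sigma\in\mathfrak{S}_n$ has the $(\delta,\epsilon,\gamma)$-property if, for every interval $I\subset\mathbb{Z}_n$ with $|I|\geq\delta n$ and every interval $J\subset\mathbb{Z}_n$ with $|J|\leq\epsilon n$, we have $|\sigma(I)\cap J|\leq\gamma|I|$. For $\tau\in\mathfrak{S}_m$ and $\sigma\in\mathfrak{S}_n$, $\Lambda^\tau(\sigma)$ is the number of sets $\{x_0<\cdots<x_{m-1}\}\subset\mathbb{Z}_n$ such that for all $i,j$: $\sigma(x_i)<\sigma(x_j)$ iff $\tau(i)<\tau(j)$. A permutation $\sigma$ is $m$-universal if $\Lambda^\tau(\sigma)>0$ for each $\tau\in\mathfrak{S}_m$. *)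

(* Defs.v *)
From mathcomp Require Import all_boot all_order all_fingroup all_algebra.
From mathcomp Require Import reals.

Set Implicit Arguments.
Unset Strict Implicit.
Unset Printing Implicit Defensive.

Import Order.TTheory GRing.Theory Num.Theory.

(* Intervals are for the linear order of {0, ..., n-1}: no wrapping modulo n.
   The empty set counts as an interval; for gamma >= 0 an empty I or J
   satisfies the bound in [has_property], so this convention is immaterial. *)
Definition ord_interval (n : nat) (I : {set 'I_n}) : Prop :=
  exists a b : nat, I = [set i : 'I_n | a <= i < b].

Definition has_property (R : realType) (n : nat) (delta eps gamma : R)
    (sigma : 'S_n) : Prop :=
  forall I J : {set 'I_n},
    ord_interval I -> ord_interval J ->
    (delta * n%:R <= #|I|%:R)%R ->
    (#|J|%:R <= eps * n%:R)%R ->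
    (#|(sigma @: I) :&: J|%:R <= gamma * #|I|%:R)%R.

Definition is_occurrence (m n : nat) (tau : 'S_m) (sigma : 'S_n)
    (x : {ffun 'I_m -> 'I_n}) : bool :=
  [forall i : 'I_m, forall j : 'I_m, (i < j) ==> (x i < x j)] &&
  [forall i : 'I_m, forall j : 'I_m,
     (sigma (x i) < sigma (x j)) == (tau i < tau j)].

Definition Lambda (m n : nat) (tau : 'S_m) (sigma : 'S_n) : nat :=
  #|[set X : {set 'I_n} |
      [exists x : {ffun 'I_m -> 'I_n},
         is_occurrence tau sigma x && (X == [set x i | i : 'I_m])]]|.

Definition universal (m n : nat) (sigma : 'S_n) : Prop :=
  forall tau : 'S_m, 0 < Lambda tau sigma.

(* Main.v *)
Require Import Defs.
From mathcomp Require Import all_boot all_order all_fingroup all_algebra.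
From mathcomp Require Import reals.
From mathcomp Require Import lra.

Set Implicit Arguments.
Unset Strict Implicit.
Unset Printing Implicit Defensive.

Import Order.TTheory GRing.Theory Num.Theory.
Local Open Scope ring_scope.

(** Cut the values into K intervals of length at most eps n, and the positions
    into L = m 2^K intervals of length b with delta n <= b.  No value interval
    receives more than a fraction 1/m of a position interval, so each position
    interval meets at least m value intervals.  By pigeonhole, m position
    intervals meet exactly the same value intervals; sending the i-th of these
    position intervals to the tau(i)-th common value interval yields an
    occurrence of tau. *)

(** [enum A] lists ordinals in increasing order, so its first [m] entries serve. Used both for
    position blocks and for value blocks. *)
Lemma increasing_selection (L m : nat) (A : {set 'I_L}) :
  (m <= #|A|)%N ->
  exists g : 'I_m -> 'I_L,
    (forall i, g i \in A) /\ (forall i j : 'I_m, (i < j)%N -> (g i < g j)%N).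
Proof.
move=> leA; exists (fun i => enum_val (widen_ord leA i)).
split=> [i|i j ltij]; first exact: enum_valP.
have sA : sorted ltn (map val (enum A)).
  rewrite sorted_map /enum_mem -enumT.
  apply: sorted_filter => [x y z|]; first exact: ltn_trans.
  by rewrite -sorted_map val_enum_ord iota_ltn_sorted.
have sz k : (k < m)%N -> (k < size (enum A))%N.
  by move=> ltk; rewrite -cardE (leq_trans ltk).
set x0 := enum_default (widen_ord leA i).
rewrite (enum_val_nth x0) [X in (_ < nat_of_ord X)%N](enum_val_nth x0) /=.
rewrite -!(nth_map x0 0%N val) ?sz //.
by apply: (sorted_ltn_nth ltn_trans) => //; rewrite inE size_map sz.
Qed.

(** The fibres of [f] partition [A] and each holds at most a fraction [1/m] of it. *)
Lemma card_imset_ge (T U : finType) (f : T -> U) (A : {set T}) (m : nat) :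
  (0 < #|A|)%N ->
  (forall u, (m * #|A :&: f @^-1: [set u]| <= #|A|)%N) ->
  (m <= #|f @: A|)%N.
Proof.
move=> A_gt0 small; rewrite -(leq_pmul2r A_gt0) -[X in (m * X <= _)%N]sum1_card.
rewrite (partition_big_imset f) big_distrr /= -sum_nat_const.
apply: leq_sum => u _; apply: leq_trans (small u).
rewrite leq_mul2l -sum1_card; apply/orP; right.
by rewrite (eq_bigl (mem (A :&: f @^-1: [set u]))) // => x; rewrite !inE.
Qed.

Lemma pigeonhole_fiber (T U : finType) (f : T -> U) (m : nat) :
  (0 < m)%N -> (m * #|U| <= #|T|)%N -> (0 < #|U|)%N ->
  exists u, (m <= #|f @^-1: [set u]|)%N.
Proof.
move=> m_gt0 leUT U_gt0; apply/existsP; apply: contraLR leUT.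
rewrite negb_exists -ltnNge => /forallP small.
have -> : #|T| = (\sum_u #|f @^-1: [set u]|)%N.
  rewrite -sum1_card (partition_big f predT) //=; apply: eq_bigr => u _.
  by rewrite -sum1_card; apply: eq_bigl => x; rewrite [RHS]inE inE.
apply: (@leq_ltn_trans (\sum_(u : U) m.-1)%N).
  by apply: leq_sum => u _; have := small u; rewrite -ltnNge -{1}(prednK m_gt0) ltnS.
by rewrite sum_nat_const mulnC ltn_pmul2r // prednK.
Qed.

Lemma card_ord_interval (n a b : nat) :
  (b <= n)%N -> #|[set i : 'I_n | (a <= i < b)%N]| = (b - a)%N.
Proof.
move=> le_bn; rewrite -sum1dep_card.
rewrite -(big_mkord (fun i => a <= i < b)%N (fun=> 1%N)) -[RHS]muln1.
rewrite -sum_nat_const_nat [RHS](big_nat_widenl a 0) // [RHS](big_nat_widen _ b n) //.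
Qed.

(** Needed for value blocks, the last of which may run past [n]; truncating at [n] reduces to the
    exact count. *)
Lemma card_ord_interval_le (n a b : nat) :
  (#|[set i : 'I_n | (a <= i < b)%N]| <= b - a)%N.
Proof.
have -> : [set i : 'I_n | (a <= i < b)%N] =
          [set i : 'I_n | (a <= i < minn b n)%N].
  by apply/setP => i; rewrite !inE leq_min ltn_ord andbT.
by rewrite card_ord_interval ?geq_minr // leq_sub2r ?geq_minl.
Qed.

Lemma occurrence_Lambda_gt0 (m n : nat) (tau : 'S_m) (sigma : 'S_n)
    (x : {ffun 'I_m -> 'I_n}) :
  is_occurrence tau sigma x -> (0 < Lambda tau sigma)%N.
Proof.
move=> occ; apply/card_gt0P; exists [set x i | i : 'I_m].
by rewrite inE; apply/existsP; exists x; rewrite occ eqxx.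
Qed.

(** One direction of the order equivalence suffices: both orders are total and [tau] is
    injective. *)
Lemma increasing_occurrence (m n : nat) (tau : 'S_m) (sigma : 'S_n)
    (x : {ffun 'I_m -> 'I_n}) :
  (forall i j : 'I_m, (i < j)%N -> (x i < x j)%N) ->
  (forall i j : 'I_m, (tau i < tau j)%N -> (sigma (x i) < sigma (x j))%N) ->
  is_occurrence tau sigma x.
Proof.
move=> x_inc sx_inc; apply/andP; split; apply/forallP => i; apply/forallP => j.
  by apply/implyP; apply: x_inc.
apply/eqP; case: (ltngtP (tau i) (tau j)) => [lt|gt|eq].
- exact: sx_inc.
- by apply/negbTE; rewrite -leqNgt ltnW // sx_inc.
- by have /perm_inj -> := ord_inj eq; rewrite ltnn.
Qed.

(** The purely combinatorial core. The [L] position blocks of length [b] must fit inside [n],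
    whereas the [K.+1] value blocks of length [a] must cover it, hence the opposite inequalities. *)
Lemma universal_of_grid (m n K L a b : nat) (sigma : 'S_n) :
  (0 < m)%N -> (0 < b)%N -> (L * b <= n)%N -> (n <= K.+1 * a)%N ->
  (m * 2 ^ K.+1 <= L)%N ->
  (forall s t : nat, (s < L)%N ->
     (m * #|(sigma @: [set i : 'I_n | s * b <= i < s.+1 * b]) :&:
            [set i : 'I_n | t * a <= i < t.+1 * a]| <= b)%N) ->
  universal m sigma.
Proof.
move=> m_gt0 b_gt0 le_Lb le_Ka le_mL small tau.
pose I (s : nat) := [set i : 'I_n | (s * b <= i < s.+1 * b)%N].
(* The default of [inord] is never reached, since [v < n <= K.+1 * a]. *)
pose blk (v : 'I_n) : 'I_K.+1 := inord (v %/ a).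
have a_gt0 : (0 < a)%N.
  have L_gt0 : (0 < L)%N by rewrite (leq_trans _ le_mL) // muln_gt0 m_gt0 expn_gt0.
  have : (0 < K.+1 * a)%N.
    by apply: leq_trans le_Ka; apply: leq_trans le_Lb; rewrite muln_gt0 L_gt0.
  by rewrite muln_gt0.
have blkE v : blk v = (v %/ a)%N :> nat.
  by rewrite inordK // ltn_divLR // (leq_trans (ltn_ord v)).
have blk_lt v w : (blk v < blk w)%N -> (v < w)%N.
  by rewrite !blkE; apply: contraLR; rewrite -!leqNgt; apply: leq_div2r.
have cardI (s : 'I_L) : #|sigma @: I s| = b.
  rewrite card_imset; last exact: perm_inj.
  rewrite card_ord_interval -?mulnBl ?subSnn ?mul1n //.
  by apply: leq_trans le_Lb; rewrite leq_mul2r (ltn_ord s) orbT.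
pose hit (s : 'I_L) := blk @: (sigma @: I s).
have hit_ge s : (m <= #|hit s|)%N.
  apply: card_imset_ge => [|t]; rewrite cardI //.
  (* The fibre of [blk] over [t] lies in the value block [t]. *)
  apply: leq_trans (small s t (ltn_ord s)); rewrite leq_mul2l.
  apply/orP; right; apply/subset_leq_card/setIS/subsetP => v.
  rewrite !inE => /eqP <-; rewrite blkE leq_divM.
  by rewrite ltn_ceil.
(* [hit] has at most [2 ^ K.+1] values, so some [T] is shared by [m] position blocks. *)
have [|//|T leT] := @pigeonhole_fiber _ _ hit m m_gt0.
- by rewrite card_ord -cardsT -powersetT card_powerset cardsT card_ord.
- by apply/card_gt0P; exists set0.
have [s [sT s_inc]] := increasing_selection leT.
(* [T] equals [hit] of a selected block, so it has at least [m] elements. *)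
have [g [gT g_inc]] : exists g : 'I_m -> 'I_K.+1,
    (forall i, g i \in T) /\ (forall i j : 'I_m, (i < j)%N -> (g i < g j)%N).
  apply: increasing_selection.
  by have := sT (Ordinal m_gt0); rewrite !inE => /eqP <-.
have /fin_all_exists[x xP] i : exists y : 'I_n,
    y \in I (s i) /\ blk (sigma y) = g (tau i).
  have := gT (tau i); have := sT i; rewrite !inE => /eqP <-.
  by case/imsetP=> _ /imsetP[y Iy ->] ->; exists y.
apply: (@occurrence_Lambda_gt0 _ _ _ _ (finfun x)).
apply: increasing_occurrence => i j; rewrite !ffunE => lt_ij.
- have [[+ _] [+ _]] := (xP i, xP j); rewrite !inE => /andP[_ lt_x] /andP[le_x _].
  apply: leq_trans lt_x (leq_trans _ le_x).
  by rewrite leq_mul2r s_inc ?orbT.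
- by apply: blk_lt; rewrite (xP i).2 (xP j).2 g_inc.
Qed.

Theorem proposition4 (R : realType) (m : nat) (eps : R) :
  (2 <= m)%N -> 0 < eps ->
  exists delta : R, 0 < delta < eps /\
    exists N : nat, forall n : nat, (N <= n)%N ->
      forall sigma : 'S_n,
        has_property delta eps (m%:R^-1) sigma -> universal m sigma.
Proof.
move=> m_ge2 eps_gt0; have m_gt0 : (0 < m)%N by apply: ltnW.
(* The factor 2 leaves room for rounding the value block length up. *)
have [K ltK] : exists K : nat, 2 < eps * K.+1%:R.
  exists (Num.bound (2 / eps)); rewrite mulrC -ltr_pdivrMr //.
  have h : 0 <= 2 / eps by rewrite divr_ge0 // ltW.
  by apply: lt_trans (archi_boundP h) _; rewrite ltr_nat.
pose L := (m * 2 ^ K.+1)%N.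
have le_KL : (K.+1 <= L)%N.
  by apply: leq_trans (leq_pmull _ m_gt0); exact: ltnW (ltn_expl _ _).
have L_gt0 : (0 < L)%N by apply: leq_trans le_KL.
have LR_gt0 : 0 < L%:R :> R by rewrite ltr0n.
have KL : K.+1%:R <= L%:R :> R by rewrite ler_nat.
have epsL : 2 < eps * L%:R by apply: lt_le_trans ltK _; rewrite ler_pM2l.
(* Half of [1/L]: rounding [n / L] down loses at most half of it once [n >= 2 * L]. *)
exists (2 * L%:R)^-1; split.
  rewrite invr_gt0 mulr_gt0 //= -[X in X < _]mul1r ltr_pdivrMr ?mulr_gt0 //.
  by lra.
exists (2 * L)%N => n le_n sigma prop.
have nR : 2 * L%:R <= n%:R :> R by rewrite -natrM ler_nat.
have le_Ln : (L <= n)%N by rewrite (leq_trans _ le_n) // leq_pmull.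
(* Rounded down so that the position blocks fit, and up so that the value blocks cover. *)
pose b := (n %/ L)%N; pose a := (n %/ K.+1).+1.
have b_gt0 : (0 < b)%N by rewrite divn_gt0.
have bR : (2 * L%:R)^-1 * n%:R <= b%:R :> R.
  rewrite mulrC ler_pdivrMr ?mulr_gt0 //.
  have : n%:R <= (b.+1 * L)%:R :> R by rewrite ler_nat ltnW // ltn_ceil.
  by rewrite natrM -natr1; lra.
have aR : a%:R <= eps * n%:R.
  (* With [q] the floor of [n / K.+1], [2 * q <= eps * n]; also [eps * n >= 2 * eps * L > 4], which
     absorbs the [+1] in [a]. *)
  have : (n %/ K.+1 * K.+1)%:R <= n%:R :> R by rewrite ler_nat leq_divM.
  rewrite natrM /a -[(_ %/ _).+1%:R]natr1; set q := (n %/ K.+1)%:R => qK.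
  have q_ge0 : 0 <= q by rewrite ler0n.
  have : 2 * q <= eps * n%:R.
    apply: (@le_trans _ _ (eps * (q * K.+1%:R))); last by rewrite ler_pM2l.
    by rewrite mulrCA mulrC; apply: ler_wpM2l => //; apply: ltW.
  have : eps * (2 * L%:R) <= eps * n%:R by rewrite ler_pM2l.
  by lra.
apply: (@universal_of_grid m n K L a b) => // [||s t lt_sL].
- by rewrite mulnC leq_divM.
- by rewrite mulnC ltnW // ltn_ceil.
have cardI : #|[set i : 'I_n | (s * b <= i < s.+1 * b)%N]| = b.
  rewrite card_ord_interval -?mulnBl ?subSnn ?mul1n //.
  by apply: leq_trans (leq_divM n L); rewrite mulnC leq_mul2l lt_sL orbT.
rewrite -(ler_nat R) natrM -ler_pdivlMl ?ltr0n //.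
have := prop [set i : 'I_n | (s * b <= i < s.+1 * b)%N]
             [set i : 'I_n | (t * a <= i < t.+1 * a)%N].
rewrite cardI; apply=> //; [by exists (s * b)%N, (s.+1 * b)%N
                           |by exists (t * a)%N, (t.+1 * a)%N|].
apply: le_trans aR; rewrite ler_nat.
by rewrite (leq_trans (card_ord_interval_le _ _ _)) // -mulnBl subSnn mul1n.
Qed.
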